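(* Let $A$ be a two-element set. If $\mathcal{C}$ is a clone on $A$ that is not a discriminator clone, then $\equiv_{\mathcal{C}}$ has infinite index in $\mathcal{O}_A$ (that is, there are infinitely many $\mathcal{C}$-equivalence classes of operations on $A$).
   Context: For a nonempty set $A$ and an integer $n\ge1$, an $n$-ary operation on $A$ is a function $A^n\to A$; $\mathcal{O}_A^{(n)}$ is the set of all $n$-ary operations and $\mathcal{O}_A=\bigcup_{n\ge1}\mathcal{O}_A^{(n)}$. The projections are $p_i^{(n)}(a_1,\dots,a_n)=a_i$ ($1\le i\le n$). An $m$-tuple $\mathbf{h}=(h_1,\dots,h_m)$ of $n$-ary operations is identified with the function $\mathbf{h}\colon A^n\to A^m$, and for $g\in\mathcal{O}_A^{(m)}$, $g\circ\mathbf{h}=g(h_1,\dots,h_m)\in\mathcal{O}_A^{(n)}$. A clone on $A$ is a set $\mathcal{C}\subseteq\mathcal{O}_A$ containing all projections and closed under composition: $g\circ\mathbf{h}\in\mathcal{C}$ whenever $g\in\mathcal{C}$ is $m$-ary and $\mathbf{h}$ is an $m$-tuple of $n$-ary members of $\mathcal{C}$. $\mathcal{C}^{(n)}$ is the set of $n$-ary members of $\mathcal{C}$. For a clone $\mathcal{C}$ on $A$, $f\in\mathcal{O}_A^{(n)}$ and $g\in\mathcal{O}_A^{(m)}$: $f\leq_{\mathcal{C}}g$ if $f=g\circ\mathbf{h}$ for some $\mathbf{h}\in(\mathcal{C}^{(n)})^m$; $f$ and $g$ are $\mathcal{C}$-equivalent, written $f\equiv_{\mathcal{C}}g$, if $f\leq_{\mathcal{C}}g$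 and $g\leq_{\mathcal{C}}f$. The discriminator function on $A$ is the ternary operation $t$ with $t(x,y,z)=z$ if $x=y$ and $t(x,y,z)=x$ otherwise. A discriminator clone on $A$ is a clone on $A$ that contains $t$. *)

(* Defs.v *)
From mathcomp Require Import all_boot.
From mathcomp Require Import mathcomp_extra boolp classical_sets cardinality.

Set Implicit Arguments.
Unset Strict Implicit.
Unset Printing Implicit Defensive.

Local Open Scope classical_set_scope.

Section Clones.
Variable A : finType.

Definition nary_op (n : nat) := {ffun n.-tuple A -> A}.

(* The disjoint union of the [nary_op n] over [n >= 1]: the index [n] of the
   sigma type stands for arity [n.+1], so there are no nullary operations. *)
Definition operation := {n : nat & nary_op n.+1}.

Definition mkop n (f : nary_op n.+1) : operation :=
  existT (fun n => nary_op n.+1) n f.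

Definition proj_op n (i : 'I_n) : nary_op n :=
  [ffun a : n.-tuple A => tnth a i].

Definition comp_op m n (g : nary_op m) (h : 'I_m -> nary_op n) : nary_op n :=
  [ffun a : n.-tuple A => g [tuple h i a | i < m]].

Definition is_clone (C : set operation) : Prop :=
  (forall n (i : 'I_n.+1), C (mkop (proj_op i))) /\
  (forall m n (g : nary_op m.+1) (h : 'I_m.+1 -> nary_op n.+1),
     C (mkop g) -> (forall i, C (mkop (h i))) -> C (mkop (comp_op g h))).

(* [f] and [g] may have different arities. *)
Definition clone_le (C : set operation) (f g : operation) : Prop :=
  exists h : 'I_(tag g).+1 -> nary_op (tag f).+1,
    (forall i, C (mkop (h i))) /\ tagged f = comp_op (tagged g) h.

Definition clone_equiv (C : set operation) (f g : operation) : Prop :=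
  clone_le C f g /\ clone_le C g f.

Definition clone_class (C : set operation) (f : operation) : set operation :=
  [set g | clone_equiv C f g].

Definition discriminator : nary_op 3 :=
  [ffun a : 3.-tuple A =>
     let x := tnth a (inord 0) in
     let y := tnth a (inord 1) in
     let z := tnth a (inord 2) in
     if x == y then z else x].

Definition is_discriminator_clone (C : set operation) : Prop :=
  is_clone C /\ C (mkop discriminator).

End Clones.

(* Main.v *)
Require Import Defs.
From mathcomp Require Import all_boot.
From mathcomp Require Import mathcomp_extra boolp classical_sets cardinality.

(** Coding the two-element set by the Booleans, it suffices to treat a Boolean
    clone [D] that does not contain the discriminator.

    Such a clone consists of monotone operations, or of operations preserving
    disjointness of bit vectors, or of operations with the dual property, or of
    affine operations ([bool_dichotomy]). To see this, let [D] contain an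
    operation outside each of these four classes. If [D] contains negation, a
    non-affine member yields conjunction or majority, and from these the
    discriminator ([neg_disc]). If [D] contains a constant but not negation,
    then up to duality the constant is 0, and [D] contains exclusive or and
    conjunction ([zero_disc]). Otherwise [D] is idempotent, and the
    discriminator is interpolated by members of [D] on larger and larger sets
    of points ([idem_disc]): if [n >= 3] points are the first ones on which this
    fails, the errors made by members of [D] on three of these points are
    exactly the vectors of odd weight, which makes every operation in [D]
    affine.

    For each of the four classes there is a sequence [G n] of operations, of
    arity [n.+1], such that [G n] is below [G m] only if [n <= m]: the parity
    functions for monotone operations ([bpar_le], by the length of alternating
    chains), disjunctions for the operations preserving disjointness
    ([bor_le], by counting disjoint nonzero vectors), their duals, and
    conjunctions for affine operations ([band_le], by counting points). These
    operations are pairwise inequivalent. *)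

Set Implicit Arguments.
Unset Strict Implicit.
Unset Printing Implicit Defensive.

(** * Boolean clones *)

(** Boolean operations of arity [n.+1], as functions of a bit vector. *)
Definition bop (n : nat) := ('I_n.+1 -> bool) -> bool.

(** Sets of Boolean operations, sorted by arity. *)
Definition bset := forall n, bop n -> Prop.

Definition bool_clone (D : bset) : Prop :=
  (forall n (i : 'I_n.+1), D n (fun x => x i)) /\
  (forall m n (g : bop m) (h : 'I_m.+1 -> bop n),
     D m g -> (forall i, D n (h i)) -> D n (fun x => g (fun i => h i x))).

(** The quasiorder on Boolean operations induced by a clone. *)
Definition ble (D : bset) n m (f : bop n) (g : bop m) :=
  exists h : 'I_m.+1 -> bop n,
    (forall i, D n (h i)) /\ f = (fun x => g (fun i => h i x)).

(** * Four properties of Boolean operations *)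

Definition bmono n (g : bop n) : Prop :=
  forall a b : 'I_n.+1 -> bool, (forall i, a i -> b i) -> g a -> g b.

(** [g] does not take the value [true] at two disjoint bit vectors. *)
Definition bdisj n (g : bop n) : Prop :=
  forall a b : 'I_n.+1 -> bool, (forall i, ~~ (a i && b i)) -> ~~ (g a && g b).

(** The dual of [bdisj]. *)
Definition bcodisj n (g : bop n) : Prop :=
  forall a b : 'I_n.+1 -> bool, (forall i, a i || b i) -> g a || g b.

(** [g] is an affine function over the two-element field. *)
Definition blin n (g : bop n) : Prop :=
  forall a b c : 'I_n.+1 -> bool, g (fun i => a i (+) b i (+) c i) = g a (+) g b (+) g c.

(** * Infinite families for the four properties *)

(** Parity, disjunction and conjunction of [n.+1] arguments. *)
Definition bpar n : bop n := fun x => odd (\sum_i x i).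
Definition bor n : bop n := fun x => [exists i, x i].
Definition band n : bop n := fun x => [forall i, x i].

Lemma sum_initial n k : k <= n -> \sum_(i < n) (i < k) = k.
Proof.
elim: n k => [|n IH] k; first by rewrite leqn0 big_ord0 => /eqP.
rewrite leq_eqVlt ltnS => /orP[/eqP ->|lekn]; rewrite big_ord_recr /=.
  rewrite ltnSn -[in RHS]addn1; congr addn.
  rewrite -[RHS]IH //; apply: eq_bigr => i _.
  by rewrite (ltn_ord i) ltnS ltnW ?ltn_ord.
by rewrite IH // ltnNge lekn addn0.
Qed.

(** An increasing chain of length [n.+2] along which parity alternates is
    mapped by monotone operations to a strictly increasing chain. *)
Lemma bpar_le (D : bset) n m : (forall k (g : bop k), D k g -> bmono g) ->
  ble D (@bpar n) (@bpar m) -> n <= m.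
Proof.
move=> Dmono [h [Dh parE]].
pose x k : 'I_n.+1 -> bool := fun i => i < k.
pose w k := \sum_i h i (x k).
have w_odd k : k <= n.+1 -> odd (w k) = odd k.
  move=> lekn; have := congr1 (fun F : bop n => F (x k)) parE.
  by rewrite /bpar sum_initial // => ->.
have w_ge k : k <= n.+1 -> k <= w k.
  elim: k => // k IH ltkn; have lekw := IH (ltnW ltkn).
  have leww : w k <= w k.+1.
    apply: leq_sum => i _.
    have := Dmono _ _ (Dh i) (x k) (x k.+1).
    case: (h i (x k)) => // -> // j; rewrite /x => ltjk.
    exact: leq_trans ltjk _.
  apply: leq_ltn_trans lekw _; rewrite ltn_neqAle leww andbT.
  apply/eqP => eqw; have := w_odd _ ltkn.
  by rewrite -eqw w_odd ?(ltnW ltkn) //=; case: (odd k).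
rewrite -ltnS; apply: leq_trans (w_ge _ (leqnn _)) _.
apply: (@leq_trans (\sum_(i < m.+1) 1)); first by apply: leq_sum => i _; apply: leq_b1.
by rewrite sum1_card card_ord.
Qed.

(** The unit vectors are mapped to nonzero, pairwise disjoint vectors. *)
Lemma bor_le (D : bset) n m : (forall k (g : bop k), D k g -> bdisj g) ->
  ble D (@bor n) (@bor m) -> n <= m.
Proof.
move=> Ddisj [h [Dh orE]].
pose phi (k : 'I_n.+1) := odflt ord0 [pick i | h i (fun j => j == k)].
have phiP k : h (phi k) (fun j => j == k).
  rewrite /phi; case: pickP => //= h0.
  have := congr1 (fun F : bop n => F (fun j => j == k)) orE; rewrite /bor.
  have -> : [exists i, i == k] by apply/existsP; exists k.
  by move/esym/existsP => [i]; rewrite h0.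
have phi_inj : injective phi.
  move=> k l eq_phi; apply/eqP; apply: contraT => neqkl.
  have := Ddisj _ _ (Dh (phi k)) (fun j => j == k) (fun j => j == l).
  rewrite phiP eq_phi phiP => disj; suff: ~~ (true && true) by []; apply: disj => i.
  by apply/andP => -[/eqP -> /eqP eqkl]; rewrite eqkl eqxx in neqkl.
by have := leq_card phi phi_inj; rewrite !card_ord.
Qed.

(** If [h] were not injective, say [h x = h y], then [h] would take the same
    value at [1] and at [1 + x + y], whereas [band n] distinguishes them. *)
Lemma band_le (D : bset) n m : (forall k (g : bop k), D k g -> blin g) ->
  ble D (@band n) (@band m) -> n <= m.
Proof.
move=> Dlin [h [Dh andE]].
pose phi (x : {ffun 'I_n.+1 -> bool}) := [ffun i => h i x].
have phi_inj : injective phi.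
  move=> x y eq_phi.
  have hE : (fun i => h i (fun j => true (+) x j (+) y j)) =
            (fun i => h i (fun=> true)).
    apply: funext => i; rewrite (Dlin _ _ (Dh i) (fun=> true)).
    move/ffunP: eq_phi => /(_ i); rewrite !ffunE => ->.
    by rewrite -addbA addbb addbF.
  have := congr1 (fun F : bop n => F (fun=> true)) andE; rewrite -hE.
  rewrite -(congr1 (fun F : bop n => F _) andE) /band.
  have -> : [forall i : 'I_n.+1, true] by apply/forallP.
  move/esym/forallP => xy; apply/ffunP => i.
  by have := xy i; case: (x i); case: (y i).
by have := leq_card phi phi_inj; rewrite !card_ffun card_bool !card_ord leq_exp2l.
Qed.

(** * Ternary members of a Boolean clone *)

(** Curried ternary operations. *)
Definition op3 := bool -> bool -> bool -> bool.

(** [T], read as a ternary operation, belongs to [D]. *)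
Definition mem3 (D : bset) (T : op3) : Prop :=
  D 2 (fun x => T (x (inord 0)) (x (inord 1)) (x (inord 2))).

(** The discriminator on the Booleans. *)
Definition disc : op3 := fun x y z => if x == y then z else x.

Section Ternary.
Variables (D : bset) (cloneD : bool_clone D).
Arguments D n _ : clear implicits.
Local Notation P := (mem3 D).

Lemma mem3_x : P (fun x _ _ => x). Proof. by case: cloneD => pr _; apply: pr. Qed.
Lemma mem3_y : P (fun _ y _ => y). Proof. by case: cloneD => pr _; apply: pr. Qed.
Lemma mem3_z : P (fun _ _ z => z). Proof. by case: cloneD => pr _; apply: pr. Qed.

Lemma mem3_comp m (g : bop m) (h : 'I_m.+1 -> op3) : D m g ->
  (forall i, P (h i)) -> P (fun x y z => g (fun i => h i x y z)).
Proof.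
case: cloneD => _ co Dg Ph.
exact: (co _ _ g (fun i x => h i (x (inord 0)) (x (inord 1)) (x (inord 2)))).
Qed.

Lemma mem3_sub (T a b c : op3) : P T -> P a -> P b -> P c ->
  P (fun x y z => T (a x y z) (b x y z) (c x y z)).
Proof.
move=> PT Pa Pb Pc.
have := @mem3_comp 2 _ (fun i : 'I_3 => nth a [:: a; b; c] i) PT.
rewrite !inordK //=; apply.
by case=> -[|[|[|]]].
Qed.

(** If two bit vectors witness the failure of a property for [g], identifying
    the variables of [g] at which they take the same pair of values leaves only
    the pairs allowed by the relation that the property preserves, hence a
    ternary operation. *)
Lemma not_mono3 m (g : bop m) : D m g -> ~ bmono g ->
  exists2 h, P h & h false false true = true /\ h false true true = false.
Proof.
move=> Dg ngm; have [a [b [ab [ga gb]]]] :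
    exists a b : 'I_m.+1 -> bool, (forall i, a i -> b i) /\ g a /\ g b = false.
  apply: contrapT => H; apply: ngm => a b ab ga.
  by case E: (g b) => //; case: H; exists a, b.
exists (fun x y z => g (fun i => if a i then z else if b i then y else x)).
  apply: (mem3_comp
    (h := fun i x y z => if a i then z else if b i then y else x)) => // i.
  by case: (a i) (b i) => -[]; [apply: mem3_z..|apply: mem3_y|apply: mem3_x].
split; rewrite -?ga -?gb; congr g; apply: funext => i.
  by case: (a i) (b i) => -[].
by move: (ab i); case: (a i) (b i) => -[] // /(_ isT).
Qed.

Lemma not_disj3 m (g : bop m) : D m g -> ~ bdisj g ->
  exists2 f, P f & f false false true = true /\ f false true false = true.
Proof.
move=> Dg ngm; have [a [b [ab [ga gb]]]] :
    exists a b : 'I_m.+1 -> bool, (forall i, ~~ (a i && b i)) /\ g a /\ g b.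
  apply: contrapT => H; apply: ngm => a b ab; apply/andP => -[ga gb].
  by case: H; exists a, b.
exists (fun x y z => g (fun i => if a i then z else if b i then y else x)).
  apply: (mem3_comp
    (h := fun i x y z => if a i then z else if b i then y else x)) => // i.
  by case: (a i) (b i) => -[]; [apply: mem3_z..|apply: mem3_y|apply: mem3_x].
split; [rewrite -ga|rewrite -gb]; congr g; apply: funext => i;
by move: (ab i); case: (a i) (b i) => -[].
Qed.

Lemma not_codisj3 m (g : bop m) : D m g -> ~ bcodisj g ->
  exists2 f, P f & f true true false = false /\ f true false true = false.
Proof.
move=> Dg ngm; have [a [b [ab [ga gb]]]] :
    exists a b : 'I_m.+1 -> bool, (forall i, a i || b i) /\ g a = false /\ g b = false.
  apply: contrapT => H; apply: ngm => a b ab.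
  case ga: (g a) => //; case gb: (g b) => //.
  by case: H; exists a, b.
exists (fun x y z => g (fun i => if ~~ a i then z else if ~~ b i then y else x)).
  apply: (mem3_comp
    (h := fun i x y z => if ~~ a i then z else if ~~ b i then y else x)) => // i.
  by case: (a i) (b i) => -[] /=; [apply: mem3_x|apply: mem3_y|apply: mem3_z..].
split; [rewrite -ga|rewrite -gb]; congr g; apply: funext => i;
by move: (ab i); case: (a i) (b i) => -[].
Qed.

Lemma not_lin m (g : bop m) : ~ blin g -> exists a b c,
  g (fun i => a i (+) b i (+) c i) = ~~ (g a (+) g b (+) g c).
Proof.
move=> ngl; apply: contrapT => H; apply: ngl => a b c.
apply: contrapT => ne; case: H; exists a, b, c; move: ne.
by case: (g (fun i => _)); case: (_ (+) g c).
Qed.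
End Ternary.

(** * Clones containing negation *)

(** A binary operation that is not affine is a conjunction, up to negating its
    arguments and its value. *)
Lemma odd_and (B : bool -> bool -> bool) :
  B false false (+) B false true (+) B true false (+) B true true ->
  exists e u v, forall y z, e (+) B (u (+) y) (v (+) z) = y && z.
Proof.
move=> Bodd.
(* The constants are read off the coefficients of the polynomial of [B]. *)
exists (B false false (+)
  ((B true false (+) B false false) && (B false true (+) B false false))).
exists (B false true (+) B false false), (B true false (+) B false false).
move: Bodd.
case E00: (B false false); case E01: (B false true); case E10: (B true false);
case E11: (B true true) => //= _ y z; case: y; case: z;
by rewrite /= ?E00 ?E01 ?E10 ?E11.
Qed.

(** A non-affine member yields a ternary operation that is a conjunction when
    its first argument is 0. It is the majority operation if every operation in
    the clone is self-dual, and then [maj x (~~ y) z] is the discriminator;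
    otherwise the constants and conjunction are available. *)
Lemma neg_disc (D : bset) m (k : bop m) : bool_clone D ->
  mem3 D (fun x _ _ => ~~ x) -> D m k -> ~ blin k -> mem3 D disc.
Proof.
move=> cD Pneg Dk /not_lin[a [b [c kE]]].
pose P := mem3 D.
have Px : P (fun x _ _ => x) := mem3_x cD.
have Py : P (fun _ y _ => y) := mem3_y cD.
have Pz : P (fun _ _ z => z) := mem3_z cD.
have sub := mem3_sub cD.
have PN T : P T -> P (fun x y z => ~~ T x y z).
  by move=> PT; apply: (sub _ _ _ _ Pneg PT PT PT).
have Padd e T : P T -> P (fun x y z => e (+) T x y z).
  by case: e => [/PN|].
(* Translating by [a] and identifying coordinates gives a quaternary
   operation whose values on the even vectors starting with 0 have odd sum. *)
pose F w p q r := k (fun j => a j (+)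
  (if a j (+) b j then if a j (+) c j then r else q
   else if a j (+) c j then p else w)).
have PF h0 h1 h2 h3 : P h0 -> P h1 -> P h2 -> P h3 ->
    P (fun x y z => F (h0 x y z) (h1 x y z) (h2 x y z) (h3 x y z)).
  move=> P0 P1 P2 P3.
  pose h j x y z := if a j (+) b j then if a j (+) c j then h3 x y z else h2 x y z
     else if a j (+) c j then h1 x y z else h0 x y z.
  apply: (mem3_comp cD (h := fun j x y z => a j (+) h j x y z) Dk) => j.
  apply: (Padd (a j) (h j)); rewrite /h.
  by case: (a j (+) b j); case: (a j (+) c j).
have Fodd : F false false false false (+) F false false true true
    (+) F false true false true (+) F false true true false.
  have -> : F false true true false = k (fun j => a j (+) b j (+) c j).
    by congr k; apply: funext => j; case: (a j); case: (b j); case: (c j).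
  have -> : F false false false false = k a.
    by congr k; apply: funext => j; case: (a j); case: (b j); case: (c j).
  have -> : F false false true true = k b.
    by congr k; apply: funext => j; case: (a j); case: (b j); case: (c j).
  have -> : F false true false true = k c.
    by congr k; apply: funext => j; case: (a j); case: (b j); case: (c j).
  by rewrite kE; case: (k a); case: (k b); case: (k c).
clearbody F.
(* The sum over some face of the cube of the last three arguments is odd. *)
have [N PN3 Nodd] : exists2 N, P N & N false false false (+) N false false true
    (+) N false true false (+) N false true true.
  apply: contrapT => noN.
  have even N : P N -> (N false false false (+) N false false true
      (+) N false true false (+) N false true true) = false.
    by move=> PN0; apply/negP => odd; apply: noN; exists N.
  move: (even _ (PF _ _ _ _ Px Px Py Pz)) (even _ (PF _ _ _ _ Px Pneg Py Pz)).
  move: (even _ (PF _ _ _ _ Px Py Px Pz)) (even _ (PF _ _ _ _ Px Py Pneg Pz)).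
  move: (even _ (PF _ _ _ _ Px Py Pz Px)) (even _ (PF _ _ _ _ Px Py Pz Pneg)).
  move: Fodd => /=.
  case: (F false false false false); case: (F false false false true);
  case: (F false false true false); case: (F false false true true);
  case: (F false true false false); case: (F false true false true);
  case: (F false true true false); case: (F false true true true) => //.
(* Up to negations, it is a conjunction when its first argument is 0. *)
have [M PM M0] : exists2 M, P M & forall y z, M false y z = y && z.
  have [e [u [v NE]]] := odd_and Nodd.
  exists (fun x y z => e (+) N x (u (+) y) (v (+) z)); last exact: NE.
  exact: (Padd _ _ (sub _ _ _ _ PN3 Px (Padd _ _ Py) (Padd _ _ Pz))).
case: (EM (forall T x y z, P T -> T (~~ x) (~~ y) (~~ z) = ~~ T x y z)) => [sd|nsd].
  (* All operations are self-dual, so [M] is the majority operation. *)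
  have M1 y z : M true y z = y || z.
    rewrite -[y]negbK -[z]negbK -[true]/(~~ false) (sd M) // M0.
    by case: y; case: z.
  have -> : disc = fun x y z => M x (~~ y) z.
    apply: funext => x; apply: funext => y; apply: funext => z.
    by case: x; rewrite /= ?M0 ?M1; case: y; case: z.
  exact: (sub _ _ _ _ PM Px (PN _ Py) Pz).
(* Otherwise the constants are present, hence all operations. *)
have P0 : P (fun _ _ _ => false).
  have [T [x [y [z [PT]]]]] : exists T x y z, P T /\ T (~~ x) (~~ y) (~~ z) = T x y z.
    apply: contrapT => H; apply: nsd => T x y z PT.
    case TE: (T (~~ x) (~~ y) (~~ z) == ~~ T x y z); first exact/eqP.
    case: H; exists T, x, y, z; split=> //.
    by move: TE; case: (T x y z); case: (T (~~ x) _ _).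
  case vE: (T x y z) => TE.
    have -> : (fun _ _ _ : bool => false) =
              (fun u _ _ => ~~ T (x (+) u) (y (+) u) (z (+) u)).
      by apply: funext => u; do 2!(apply: funext => ?); case: u;
         rewrite ?addbF ?addbT ?vE ?TE.
    exact: (PN _ (sub _ _ _ _ PT (Padd _ _ Px) (Padd _ _ Px) (Padd _ _ Px))).
  have -> : (fun _ _ _ : bool => false) =
            (fun u _ _ => T (x (+) u) (y (+) u) (z (+) u)).
    by apply: funext => u; do 2!(apply: funext => ?); case: u;
       rewrite ?addbF ?addbT ?vE ?TE.
  exact: (sub _ _ _ _ PT (Padd _ _ Px) (Padd _ _ Px) (Padd _ _ Px)).
have Pand S T : P S -> P T -> P (fun x y z => S x y z && T x y z).
  move=> PS PT; have := sub _ _ _ _ PM P0 PS PT.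
  by congr P; do 3!(apply: funext => ?); rewrite M0.
have -> : disc = fun x y z => ~~ (~~ (x && ~~ (y && ~~ z)) && ~~ (~~ x && (~~ y && z))).
  by apply: funext => -[]; apply: funext => -[]; apply: funext => -[].
exact: (PN _ (Pand _ _ (PN _ (Pand _ _ Px (PN _ (Pand _ _ Py (PN _ Pz)))))
                       (PN _ (Pand _ _ (PN _ Px) (Pand _ _ (PN _ Py) Pz))))).
Qed.

(** * Clones containing a constant *)

(** If 0 but not negation belongs to the clone, every member fixes 0. The clone
    then contains exclusive or and conjunction, and the discriminator is
    [z + (x + y)(x + z)]. *)
Lemma zero_disc (D : bset) m (k : bop m) f h : bool_clone D ->
  ~ mem3 D (fun x _ _ => ~~ x) -> mem3 D (fun _ _ _ => false) ->
  mem3 D f -> f false false true = true /\ f false true false = true ->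
  mem3 D h -> h false false true = true /\ h false true true = false ->
  D m k -> ~ blin k -> mem3 D disc.
Proof.
move=> cD nneg P0 Pf [f1 f2] Ph [h1 h2] Dk /not_lin[a [b [c kE]]].
pose P := mem3 D.
have Px : P (fun x _ _ => x) := mem3_x cD.
have Py : P (fun _ y _ => y) := mem3_y cD.
have Pz : P (fun _ _ z => z) := mem3_z cD.
have sub := mem3_sub cD.
have fix0 T : P T -> T false false false = false.
  move=> PT; case TE: (T false false false) => //; case: nneg.
  have P1 : P (fun _ _ _ => true).
    by rewrite -TE; exact: (sub _ _ _ _ PT P0 P0 P0).
  have := sub _ _ _ _ Ph P0 Px P1; rewrite -/P; congr P.
  by apply: funext => x; do 2!(apply: funext => ?); case: x; rewrite ?h1 ?h2.
have finish : P (fun x y _ => x && y) -> P (fun x y _ => x (+) y) -> P disc.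
  move=> Pand Padd.
  have -> : disc = fun x y z => z (+) ((x (+) y) && (x (+) z)).
    by apply: funext => -[]; apply: funext => -[]; apply: funext => -[].
  apply: (sub _ _ _ _ Padd Pz _ Pz).
  by apply: (sub _ _ _ _ Pand _ _ Pz); [exact: Padd|exact: (sub _ _ _ _ Padd Px Pz Pz)].
have PH : P (fun x y _ => h false x y) := sub _ _ _ _ Ph P0 Px Py.
have PK : P (fun x y _ => f false x y) := sub _ _ _ _ Pf P0 Px Py.
have h0 := fix0 _ Ph; have f0 := fix0 _ Pf.
case h3: (h false true false); last first.
  (* Here [h] yields the difference [~~ x && y]. *)
  apply: finish.
    have -> : (fun x y _ : bool => x && y) = fun x y z => h false (h false x y) y.
      by apply: funext => -[]; apply: funext => -[]; apply: funext => -[];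
         rewrite ?h0 ?h1 ?h2 ?h3 ?h0 ?h1 ?h2 ?h3.
    exact: (sub _ _ _ _ PH PH Py Pz).
  have -> : (fun x y _ : bool => x (+) y) =
            fun x y z => f false (h false x y) (h false y x).
    by apply: funext => -[]; apply: funext => -[]; apply: funext => -[];
       rewrite ?h0 ?h1 ?h2 ?h3 ?f0 ?f1 ?f2.
  exact: (sub _ _ _ _ PK PH (sub _ _ _ _ PH Py Px Pz) Pz).
(* Here [h] yields exclusive or, so linear forms may be substituted in [k]. *)
have Padd : P (fun x y _ => x (+) y).
  have -> : (fun x y _ : bool => x (+) y) = fun x y z => h false x y.
    by apply: funext => -[]; apply: funext => -[]; apply: funext => -[];
       rewrite ?h0 ?h1 ?h2 ?h3.
  exact: PH.
apply: finish => //.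
have PaddT S T : P S -> P T -> P (fun x y z => S x y z (+) T x y z).
  by move=> PS PT; exact: (sub _ _ _ _ Padd PS PT PT).
have PandT e T : P T -> P (fun x y z => e && T x y z).
  by case: e => // _; exact: P0.
pose F x y z := k (fun j => (a j && x) (+) (b j && y) (+) (c j && z)).
have PF : P F.
  apply: (mem3_comp cD
    (h := fun j x y z => (a j && x) (+) (b j && y) (+) (c j && z)) Dk) => j.
  exact: (PaddT _ _ (PaddT _ _ (PandT (a j) _ Px) (PandT (b j) _ Py)) (PandT (c j) _ Pz)).
have Fodd : F true true true = ~~ (F true false false (+) F false true false
    (+) F false false true).
  have -> : F true true true = k (fun j => a j (+) b j (+) c j).
    by congr k; apply: funext => j; rewrite !andbT.
  have -> : F true false false = k a.
    by congr k; apply: funext => j; rewrite !andbT !andbF !addbF.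
  have -> : F false true false = k b.
    by congr k; apply: funext => j; rewrite !andbT !andbF !addbF.
  have -> : F false false true = k c.
    by congr k; apply: funext => j; rewrite !andbT !andbF !addbF.
  exact: kE.
have F0 := fix0 _ PF; clearbody F.
(* Subtracting its values at the unit vectors from [F] gives an operation
   vanishing at all vectors of weight at most 1, and equal to 1 at (1, 1, 1). *)
pose L x y z := F x y z (+) (F true false false && x)
  (+) (F false true false && y) (+) (F false false true && z).
have PL : P L.
  exact: (PaddT _ _ (PaddT _ _ (PaddT _ _ PF (PandT (F true false false) _ Px))
    (PandT (F false true false) _ Py)) (PandT (F false false true) _ Pz)).
have L0 : L false false false = false by rewrite /L F0 !andbF.
have L1 : L true false false = false by rewrite /L andbT !andbF !addbF addbb.
have L2 : L false true false = false by rewrite /L andbT !andbF !addbF addbb.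
have L3 : L false false true = false by rewrite /L andbT !andbF !addbF addbb.
have L123 : L true true true.
  rewrite /L Fodd !andbT; case: (F true false false); case: (F false true false);
  by case: (F false false true).
have Pand T : P T -> T false false false = false -> T true false false = false ->
    T false true false = false -> T true true false -> P (fun x y _ => x && y).
  move=> PT T0 T1 T2 T12.
  have -> : (fun x y _ : bool => x && y) = fun x y _ => T x y false.
    by apply: funext => -[]; apply: funext => -[]; rewrite ?T0 ?T1 ?T2 ?T12.
  exact: (sub _ _ _ _ PT Px Py P0).
clearbody L.
case L12: (L true true false); first exact: (Pand L).
case L23: (L false true true).
  by apply: (Pand (fun x y z => L z x y)) => //; exact: (sub _ _ _ _ PL Pz Px Py).
by apply: (Pand (fun x y z => L x y y)) => //; exact: (sub _ _ _ _ PL Px Py Py).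
Qed.

(** * Idempotent clones *)

(** Value of a ternary operation at a point. *)
Definition ev (T : op3) (u : bool * bool * bool) := T u.1.1 u.1.2 u.2.

(** If the pairs of values of [F1], [F2] and [F3] at the points [u] and [v] are
    three different corners of the square, the fourth corner is also attained,
    by applying to them a ternary operation witnessing the failure of
    monotonicity or of one of the two disjointness properties, according to the
    missing corner. Idempotence preserves common values at other points. *)
Lemma fourth_corner (D : bset) f g h : bool_clone D ->
  (forall T b, mem3 D T -> T b b b = b) ->
  mem3 D f -> f false false true = true /\ f false true false = true ->
  mem3 D g -> g true true false = false /\ g true false true = false ->
  mem3 D h -> h false false true = true /\ h false true true = false ->
  forall F1 F2 F3 u v s t, mem3 D F1 -> mem3 D F2 -> mem3 D F3 ->
    ev F1 u = ~~ s -> ev F1 v = t -> ev F2 u = s -> ev F2 v = ~~ t ->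
    ev F3 u = ~~ s -> ev F3 v = ~~ t ->
  exists F, [/\ mem3 D F, ev F u = s, ev F v = t &
    forall w e, ev F1 w = e -> ev F2 w = e -> ev F3 w = e -> ev F w = e].
Proof.
move=> cD idem Pf [f1 f2] Pg [g1 g2] Ph [h1 h2] F1 F2 F3 u v s t P1 P2 P3.
have sub := mem3_sub cD.
have key T A B C : mem3 D T -> mem3 D A -> mem3 D B -> mem3 D C ->
    T (ev A u) (ev B u) (ev C u) = s -> T (ev A v) (ev B v) (ev C v) = t ->
    (forall w e, ev F1 w = e -> ev F2 w = e -> ev F3 w = e ->
       [/\ ev A w = e, ev B w = e & ev C w = e]) ->
    exists F, [/\ mem3 D F, ev F u = s, ev F v = t &
    forall w e, ev F1 w = e -> ev F2 w = e -> ev F3 w = e -> ev F w = e].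
  move=> PT PA PB PC Tu Tv ABC; exists (fun x y z => T (A x y z) (B x y z) (C x y z)).
  split=> // [|w e e1 e2 e3]; first exact: sub.
  have [Aw Bw Cw] := ABC _ _ e1 e2 e3.
  by rewrite /ev -/(ev A w) -/(ev B w) -/(ev C w) Aw Bw Cw idem.
case: s key; case: t => key u1 v1 u2 v2 u3 v3.
- by apply: (key f F3 F1 F2); rewrite ?u1 ?u2 ?u3 ?v1 ?v2 ?v3.
- by apply: (key h F1 F3 F2); rewrite ?u1 ?u2 ?u3 ?v1 ?v2 ?v3.
- by apply: (key h F2 F3 F1); rewrite ?u1 ?u2 ?u3 ?v1 ?v2 ?v3.
- by apply: (key g F3 F2 F1); rewrite ?u1 ?u2 ?u3 ?v1 ?v2 ?v3.
Qed.

(** The discriminator is interpolated by members of the clone on larger and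
    larger sets of points. Two points are handled by the projections and
    [fourth_corner]. Given operations [F1], [F2], [F3] that are wrong only at
    [u1], [u2], [u3] respectively, if no member is correct on the whole set then
    [fourth_corner] shows that, among the members correct at the remaining
    points, the patterns of errors at these three points are the vectors of odd
    weight. Being affine, this set of patterns forces every operation in the
    clone to be affine. *)
Lemma idem_disc (D : bset) m (k : bop m) f g h : bool_clone D ->
  (forall T b, mem3 D T -> T b b b = b) ->
  mem3 D f -> f false false true = true /\ f false true false = true ->
  mem3 D g -> g true true false = false /\ g true false true = false ->
  mem3 D h -> h false false true = true /\ h false true true = false ->
  D m k -> ~ blin k -> mem3 D disc.
Proof.
move=> cD idem Pf Ef Pg Eg Ph Eh Dk nonlin.
have fc := fourth_corner cD idem Pf Ef Pg Eg Ph Eh.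
have kidem b : k (fun=> b) = b.
  exact: (idem _ b (mem3_comp cD (h := fun _ x _ _ => x) Dk (fun=> mem3_x cD))).
have pair2 u v : ev disc u != u.1.1 ->
    exists2 F, mem3 D F & ev F u = ev disc u /\ ev F v = ev disc v.
  move=> xu; case: (eqVneq (ev disc v) v.2) => [zv|zv].
    exists (fun _ _ z => z); first exact: mem3_z.
    split=> //; case: u xu => [[x y] z]; by case: x; case: y; case: z.
  have [||||||F [PF Fu Fv _]] := fc (fun x _ _ => x) (fun _ _ z => z)
    (fun _ y _ => y) u v (ev disc u) (ev disc v) (mem3_x cD) (mem3_z cD) (mem3_y cD);
    first [by exists F|by case: u xu => [[x y] z]; case: v zv => [[x' y'] z'];
     case: x; case: y; case: z; case: x'; case: y'; case: z'].
have main n : forall W : seq (bool * bool * bool), size W = n.+1 ->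
    exists2 F, mem3 D F & {in W, forall u, ev F u = ev disc u}.
  elim: n => [|n IH] [|u1 W] //.
    case: W => // _; case: (eqVneq (ev disc u1) u1.1.1) => [xu|xu].
      exists (fun x _ _ => x); first exact: mem3_x.
      by move=> u; rewrite inE => /eqP ->.
    have [F PF [Fu _]] := pair2 _ u1 xu.
    by exists F => // u; rewrite inE => /eqP ->.
  case: W => [|u2 [|u3 W]] // [sW].
    case: (eqVneq (ev disc u1) u1.1.1) => [xu1|xu1].
      case: (eqVneq (ev disc u2) u2.1.1) => [xu2|xu2].
        exists (fun x _ _ => x); first exact: mem3_x.
        by move=> u; rewrite !inE => /orP[] /eqP ->.
      have [F PF [Fu Fv]] := pair2 _ u1 xu2.
      by exists F => // u; rewrite !inE => /orP[] /eqP ->.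
    have [F PF [Fu Fv]] := pair2 _ u2 xu1.
    by exists F => // u; rewrite !inE => /orP[] /eqP ->.
  (* [R r1 r2 r3]: some member correct on [W] has errors [r1], [r2], [r3] at
     [u1], [u2], [u3]. *)
  pose good F := mem3 D F /\ {in W, forall u, ev F u = ev disc u}.
  pose err F u := ev F u (+) ev disc u.
  pose R r1 r2 r3 := exists F, [/\ good F, err F u1 = r1, err F u2 = r2 & err F u3 = r3].
  have errE F u r : err F u = r -> ev F u = r (+) ev disc u.
    by rewrite /err => <-; rewrite -addbA addbb addbF.
  apply: contrapT => noF.
  have R000 : ~ R false false false.
    case=> F [[PF FW]] /errE E1 /errE E2 /errE E3; apply: noF; exists F => // u.
    rewrite !inE => /or4P[/eqP->|/eqP->|/eqP->|/FW //]; by rewrite ?E1 ?E2 ?E3.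
  have R100 : R true false false.
    have [|F PF FW] := IH [:: u2, u3 & W]; first by rewrite /= -sW.
    exists F.
    have gF : good F by split=> // u uW; apply: FW; rewrite !inE uW !orbT.
    have e2 : err F u2 = false by rewrite /err FW ?addbb // !inE eqxx.
    have e3 : err F u3 = false by rewrite /err FW ?addbb // !inE eqxx !orbT.
    split=> //; case e1: (err F u1) => //; by case: R000; exists F.
  have R010 : R false true false.
    have [|F PF FW] := IH [:: u1, u3 & W]; first by rewrite /= -sW.
    exists F.
    have gF : good F by split=> // u uW; apply: FW; rewrite !inE uW !orbT.
    have e1 : err F u1 = false by rewrite /err FW ?addbb // !inE eqxx.
    have e3 : err F u3 = false by rewrite /err FW ?addbb // !inE eqxx !orbT.
    split=> //; case e2: (err F u2) => //; by case: R000; exists F.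
  have R001 : R false false true.
    have [|F PF FW] := IH [:: u1, u2 & W]; first by rewrite /= -sW.
    exists F.
    have gF : good F by split=> // u uW; apply: FW; rewrite !inE uW !orbT.
    have e1 : err F u1 = false by rewrite /err FW ?addbb // !inE eqxx.
    have e2 : err F u2 = false by rewrite /err FW ?addbb // !inE eqxx !orbT.
    split=> //; case e3: (err F u3) => //; by case: R000; exists F.
  have corner F1 F2 F3 u v s t : good F1 -> good F2 -> good F3 ->
      err F1 u = ~~ s -> err F1 v = t -> err F2 u = s -> err F2 v = ~~ t ->
      err F3 u = ~~ s -> err F3 v = ~~ t ->
    exists F, [/\ good F, err F u = s, err F v = t &
      forall w e, err F1 w = e -> err F2 w = e -> err F3 w = e -> err F w = e].
    move=> [P1 W1] [P2 W2] [P3 W3] /errE E1u /errE E1v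
      /errE E2u /errE E2v /errE E3u /errE E3v.
    have [||||||F [PF Fu Fv Fw]] :=
      fc F1 F2 F3 u v (s (+) ev disc u) (t (+) ev disc v) P1 P2 P3;
      rewrite -?addNb //.
    exists F; split.
    - by split=> // w wW; apply: Fw; [apply: W1|apply: W2|apply: W3].
    - by rewrite /err Fu -addbA addbb addbF.
    - by rewrite /err Fv -addbA addbb addbF.
    - move=> w e /errE e1 /errE e2 /errE e3.
      by rewrite /err (Fw _ _ e1 e2 e3) -addbA addbb addbF.
  have nR110 : ~ R true true false.
    move: R100 R010 => [F1 [g1 a1 b1 c1]] [F2 [g2 a2 b2 c2]] [F3 [g3 a3 b3 c3]].
    have [F [gF a b c]] := corner F1 F2 F3 u1 u2 false false g1 g2 g3 a1 b1 a2 b2 a3 b3.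
    by apply: R000; exists F; split=> //; exact: c.
  have nR101 : ~ R true false true.
    move: R100 R001 => [F1 [g1 a1 b1 c1]] [F2 [g2 a2 b2 c2]] [F3 [g3 a3 b3 c3]].
    have [F [gF a c b]] := corner F1 F2 F3 u1 u3 false false g1 g2 g3 a1 c1 a2 c2 a3 c3.
    by apply: R000; exists F; split=> //; exact: b.
  have nR011 : ~ R false true true.
    move: R010 R001 => [F1 [g1 a1 b1 c1]] [F2 [g2 a2 b2 c2]] [F3 [g3 a3 b3 c3]].
    have [F [gF b c a]] := corner F1 F2 F3 u2 u3 false false g1 g2 g3 b1 c1 b2 c2 b3 c3.
    by apply: R000; exists F; split=> //; exact: a.
  have R111 : R true true true.
    move: R010 R100 R001 => [F1 [g1 a1 b1 c1]] [F2 [g2 a2 b2 c2]] [F3 [g3 a3 b3 c3]].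
    have [F [gF a b _]] := corner F1 F2 F3 u1 u2 true true g1 g2 g3 a1 b1 a2 b2 a3 b3.
    by exists F; case c: (err F u3) => //; case: nR110; exists F.
  have Rodd r1 r2 r3 : R r1 r2 r3 -> r1 (+) r2 (+) r3.
    by case: r1; case: r2; case: r3.
  have oddR r1 r2 : R r1 r2 (~~ (r1 (+) r2)).
    by case: r1; case: r2.
  apply: nonlin.
  pose p1 := ev disc u1; pose p2 := ev disc u2; pose p3 := ev disc u3.
  pose d := ~~ (p1 (+) p2 (+) p3).
  (* Vectors [a] and [b] are realised as the values at [u1] and [u2] of tuples
     of good members; the values at [u3] are then determined by parity. *)
  have kd a b : k (fun j => a j (+) b j (+) d) = k a (+) k b (+) d.
    have /choice[H HP] j := oddR (a j (+) p1) (b j (+) p2).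
    pose G x y z := k (fun j => H j x y z).
    have GR : R (k a (+) p1) (k b (+) p2) (k (fun j => a j (+) b j (+) d) (+) p3).
      exists G; split; rewrite /err.
      - split; first by apply: mem3_comp => // j; case: (HP j) => -[].
        move=> w wW; rewrite /ev /G -[RHS]kidem; congr k; apply: funext => j.
        by case: (HP j) => -[_ /(_ w wW)].
      - congr (_ (+) _); congr k; apply: funext => j.
        case: (HP j) => _ /errE; rewrite /ev => -> _ _.
        by rewrite -/(ev disc u1) -/p1 -addbA addbb addbF.
      - congr (_ (+) _); congr k; apply: funext => j.
        case: (HP j) => _ _ /errE; rewrite /ev => -> _.
        by rewrite -/(ev disc u2) -/p2 -addbA addbb addbF.
      - congr (_ (+) _); congr k; apply: funext => j.
        case: (HP j) => _ _ _ /errE; rewrite /ev => ->.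
        rewrite /d -/(ev disc u3) -/p3; clear d HP.
        by case: (a j); case: (b j); case: p1; case: p2; case: p3.
    move/Rodd: GR; case: (k (fun j => a j (+) b j (+) d)); rewrite /d; clear d HP.
      by case: (k a); case: (k b); case: p1; case: p2; case: p3.
    by case: (k a); case: (k b); case: p1; case: p2; case: p3.
  have ks a : k (fun j => a j (+) d) = k a (+) d.
    rewrite -[RHS]addbF addbAC -(kidem false) -kd; congr k; apply: funext => j.
    by rewrite addbF.
  have kadd a b : k (fun j => a j (+) b j) = k a (+) k b.
    by apply: (@addIb d); rewrite -ks kd.
  by move=> a b c; rewrite !kadd.
pose W := enum {: bool * bool * bool}.
have [|F PF FW] := main (size W).-1 W.
  by rewrite prednK // -cardE !card_prod card_bool.
have -> // : disc = F.
apply: funext => x; apply: funext => y; apply: funext => z.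
by have := FW (x, y, z); rewrite mem_enum => /(_ isT).
Qed.

(** * Duality *)

(** The dual of an operation is its conjugate by negation. *)
Definition bdual n (g : bop n) : bop n := fun x => ~~ g (fun i => ~~ x i).
Definition dual_set (D : bset) : bset := fun n g => D n (bdual g).
Definition dual3 (T : op3) : op3 := fun x y z => ~~ T (~~ x) (~~ y) (~~ z).

Lemma bdualK n : involutive (@bdual n).
Proof.
move=> g; apply: funext => x; rewrite /bdual negbK; congr g.
by apply: funext => i; rewrite negbK.
Qed.

Lemma dual_setK : involutive dual_set.
Proof.
move=> D; apply: functional_extensionality_dep => n; apply: funext => g.
by rewrite /dual_set bdualK.
Qed.

Lemma dual_clone D : bool_clone D -> bool_clone (dual_set D).
Proof.
case=> pr co; split=> [n i|m n g h Dg Dh].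
  rewrite /dual_set; have -> : bdual (fun x : 'I_n.+1 -> bool => x i) = fun x => x i.
    by apply: funext => x; rewrite /bdual negbK.
  exact: pr.
have := co _ _ _ _ Dg Dh; rewrite /dual_set; congr D; apply: funext => x.
by rewrite /bdual; congr (~~ g _); apply: funext => i; rewrite negbK.
Qed.

Lemma mem3_dual D T : mem3 D T -> mem3 (dual_set D) (dual3 T).
Proof.
rewrite /mem3 /dual_set; congr D; apply: funext => x.
by rewrite /bdual /dual3 !negbK.
Qed.

Lemma dual3_disc : dual3 disc = disc.
Proof. by apply: funext => -[]; apply: funext => -[]; apply: funext => -[]. Qed.

Lemma blin_dual n (g : bop n) : blin (bdual g) -> blin g.
Proof.
move=> lin a b c.
have gE x : g x = ~~ bdual g (fun i => ~~ x i) by rewrite -[in LHS](bdualK g).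
rewrite !gE.
have -> : (fun i => ~~ (a i (+) b i (+) c i)) =
          (fun i => ~~ a i (+) ~~ b i (+) ~~ c i).
  by apply: funext => i; case: (a i); case: (b i); case: (c i).
rewrite lin; case: (bdual g (fun i => ~~ a i)); case: (bdual g (fun i => ~~ b i));
by case: (bdual g (fun i => ~~ c i)).
Qed.

Lemma bdisj_dual n (g : bop n) : bcodisj g -> bdisj (bdual g).
Proof.
move=> cod a b ab; rewrite /bdual -negb_or negbK; apply: cod => i.
by rewrite -negb_and.
Qed.

(** * The dichotomy for Boolean clones *)

Lemma bool_dichotomy D : bool_clone D -> ~ mem3 D disc ->
  [\/ forall n g, D n g -> bmono g, forall n g, D n g -> bdisj g,
      forall n g, D n g -> bcodisj g | forall n g, D n g -> blin g].
Proof.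
move=> cD ndisc; apply: contrapT => nall.
have witness (Q : forall n, bop n -> Prop) : ~ (forall n g, D n g -> Q n g) ->
    exists n g, D n g /\ ~ Q n g.
  move=> nQ; apply: contrapT => H; apply: nQ => n g Dg; apply: contrapT => nQg.
  by apply: H; exists n, g.
have [m1 [g1 [D1 n1]]] : exists n g, D n g /\ ~ bmono g.
  by apply: witness => H; apply: nall; apply: Or41.
have [m2 [g2 [D2 n2]]] : exists n g, D n g /\ ~ bdisj g.
  by apply: witness => H; apply: nall; apply: Or42.
have [m3 [g3 [D3 n3]]] : exists n g, D n g /\ ~ bcodisj g.
  by apply: witness => H; apply: nall; apply: Or43.
have [m [k [Dk nk]]] : exists n g, D n g /\ ~ blin g.
  by apply: witness => H; apply: nall; apply: Or44.
have [h Ph [h1 h2]] := not_mono3 cD D1 n1.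
have [f Pf [f1 f2]] := not_disj3 cD D2 n2.
have [g Pg [g4 g5]] := not_codisj3 cD D3 n3.
apply: ndisc.
case: (EM (mem3 D (fun x _ _ => ~~ x))) => [Pneg|nneg].
  exact: neg_disc Dk nk.
case: (EM (mem3 D (fun _ _ _ => false))) => [P0|n0].
  exact: (zero_disc cD nneg P0 Pf _ Ph _ Dk nk).
case: (EM (mem3 D (fun _ _ _ => true))) => [P1|nc1].
  rewrite -dual3_disc -[D]dual_setK; apply: mem3_dual.
  have Ph' : mem3 D (fun x y z => h z y x).
    exact: (mem3_sub cD Ph (mem3_z cD) (mem3_y cD) (mem3_x cD)).
  apply: (zero_disc (dual_clone cD) _ (mem3_dual P1) (mem3_dual Pg) _
           (mem3_dual Ph') _ (k := bdual k)).
  - by rewrite /mem3 /dual_set /bdual => N; apply: nneg; move: N; congr D;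
       apply: funext => x; rewrite negbK.
  - by rewrite /dual3 /= g4 g5.
  - by rewrite /dual3 /= h1 h2.
  - by rewrite /dual_set bdualK.
  - by move/blin_dual.
(* The diagonal of a member is neither negation nor a constant. *)
apply: (idem_disc cD _ Pf _ Pg _ Ph _ Dk nk) => // T b PT.
have Pd : mem3 D (fun x _ _ => T x x x).
  exact: (mem3_sub cD PT (mem3_x cD) (mem3_x cD) (mem3_x cD)).
case T0: (T false false false); case T1: (T true true true).
- by case: nc1; move: Pd; congr mem3; apply: funext => -[];
  do 2!apply: funext => ?.
- by case: nneg; move: Pd; congr mem3; apply: funext => -[];
  do 2!apply: funext => ?.
- by case: b.
- by case: n0; move: Pd; congr mem3; apply: funext => -[];
  do 2!apply: funext => ?.
Qed.

Lemma bool_family D : bool_clone D -> ~ mem3 D disc ->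
  exists G : forall n, bop n, forall n m, ble D (G n) (G m) -> n <= m.
Proof.
move=> cD /(bool_dichotomy cD)[Dmono|Ddisj|Dcod|Dlin].
- by exists bpar => n m; exact: bpar_le.
- by exists bor => n m; exact: bor_le.
- exists (fun n => bdual (@bor n)) => n m [h [Dh orE]].
  apply: (@bor_le (dual_set D)) => [k g /Dcod/bdisj_dual|].
    by rewrite bdualK.
  exists (fun i => bdual (h i)); split=> [i|]; first by rewrite /dual_set bdualK.
  rewrite -[LHS]bdualK orE; apply: funext => x; rewrite /bdual negbK.
  by congr (@bor m _); apply: funext => i.
- by exists band => n m; exact: band_le.
Qed.

(** * Operations on a two-element set *)

Section Coding.
Variables (A : finType) (e : bool -> A) (d : A -> bool).
Hypotheses (eK : cancel e d) (dK : cancel d e).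

(** Transport of operations along the bijection [e], and its inverse. *)
Definition encode n (g : bop n) : nary_op A n.+1 :=
  [ffun a : n.+1.-tuple A => e (g (fun i => d (tnth a i)))].
Definition decode n (f : nary_op A n.+1) : bop n :=
  fun x => d (f [tuple e (x i) | i < n.+1]).

Lemma decodeK n : cancel (@decode n) (@encode n).
Proof.
move=> f; apply/ffunP => a; rewrite ffunE /decode dK; congr (f _).
by apply: eq_from_tnth => i; rewrite tnth_mktuple dK.
Qed.

Lemma encodeK n : cancel (@encode n) (@decode n).
Proof.
move=> g; apply: funext => x; rewrite /decode ffunE eK; congr g.
by apply: funext => i; rewrite tnth_mktuple eK.
Qed.

Lemma encode_comp m n (g : bop m) (h : 'I_m.+1 -> bop n) :
  encode (fun x => g (fun i => h i x)) = comp_op (encode g) (fun i => encode (h i)).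
Proof.
apply/ffunP => a; rewrite !ffunE; congr (e (g _)).
by apply: funext => i; rewrite tnth_mktuple ffunE eK.
Qed.

Variable C : set (operation A).

(** The set of Boolean operations corresponding to [C]. *)
Definition bool_part : bset := fun n g => C (mkop (encode g)).

Lemma bool_part_clone : is_clone C -> bool_clone bool_part.
Proof.
case=> pr co; split=> [n i|m n g h Cg Ch]; rewrite /bool_part.
  have -> : encode (fun x : 'I_n.+1 -> bool => x i) = proj_op A i.
    by apply/ffunP => a; rewrite !ffunE dK.
  exact: pr.
by rewrite encode_comp; apply: co.
Qed.

Lemma bool_part_disc : mem3 bool_part disc -> C (mkop (discriminator A)).
Proof.
rewrite /mem3 /bool_part; congr (C (mkop _)); apply/ffunP => a.
rewrite !ffunE /disc /= (can_eq dK); case: ifP => _; exact: dK.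
Qed.

Lemma bool_part_le n m (f : bop n) (g : bop m) :
  clone_le C (mkop (encode f)) (mkop (encode g)) -> ble bool_part f g.
Proof.
case=> h [Ch fE]; exists (fun i => decode (h i)); split=> [i|].
  by rewrite /bool_part decodeK.
apply: (can_inj (@encodeK n)); rewrite [RHS]encode_comp; apply: (etrans fE).
by congr comp_op; apply: funext => i; rewrite decodeK.
Qed.
End Coding.

Lemma clone_le_refl (A : finType) (C : set (operation A)) f :
  is_clone C -> clone_le C f f.
Proof.
case=> pr _; exists (fun i => proj_op A i); split=> [i|]; first exact: pr.
apply/ffunP => a; rewrite ffunE; congr (tagged f _).
by apply: eq_from_tnth => i; rewrite tnth_mktuple ffunE.
Qed.

(** Pairwise inequivalent operations represent infinitely many classes. *)
Lemma infinite_classes (A : finType) (C : set (operation A)) (F : nat -> operation A) :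
  is_clone C -> (forall n m, clone_equiv C (F n) (F m) -> n = m) ->
  infinite_set (range (clone_class C)).
Proof.
move=> cC Finj; pose c n := clone_class C (F n).
apply: (@sub_infinite_set _ (range c)); first by move=> _ [n _ <-]; exists (F n).
have c_inj : injective c.
  move=> n m cE; apply: Finj.
  have : c m (F m) by split; exact: clone_le_refl.
  by rewrite -cE.
apply/infiniteP; move: (@inj_card_eq _ _ setT c (in2W c_inj)).
by rewrite card_eq_le => /andP[].
Qed.

Theorem theorem4p7 (A : finType) (C : set (operation A)) :
  #|A| = 2 -> is_clone C -> ~ is_discriminator_clone C ->
  infinite_set (range (clone_class C)).
Proof.
move=> A2 cC ndisc.
have cAB : #|A| = #|{: bool}| by rewrite card_bool.
pose d (a : A) : bool := enum_val (cast_ord cAB (enum_rank a)).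
pose e (b : bool) : A := enum_val (cast_ord (esym cAB) (enum_rank b)).
have eK : cancel e d by move=> b; rewrite /d /e enum_valK cast_ordKV enum_rankK.
have dK : cancel d e by move=> a; rewrite /d /e enum_valK cast_ordK enum_rankK.
have [|G Gle] := bool_family (bool_part_clone eK dK cC).
  by move/(bool_part_disc dK) => Cdisc; apply: ndisc.
apply: (@infinite_classes _ _ (fun n => mkop (encode e d (G n)))) => // n m [le1 le2].
apply/eqP; rewrite eqn_leq.
by rewrite (Gle _ _ (bool_part_le eK dK le1)) (Gle _ _ (bool_part_le eK dK le2)).
Qed.
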